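(* Let $N=2^m$ with $m\ge 2$, and for $g>0$ let $|\Psi(g)\rangle$ be the normalized even-parity ground state of the one-dimensional transverse-field Ising Hamiltonian $H(J,B)$ on $N$ qubits with Jordan-Wigner boundary conditions, where $J>0$ and $g=B/J$ (as specified in the context). Let $\mathcal{B}=b_1^\dagger b_1$ be the occupation number of the Fourier fermionic mode $b_1$. Write $\langle \mathcal{B}(g)\rangle=\langle\Psi(g)|\mathcal{B}|\Psi(g)\rangle$ and $\mathrm{Var}[\mathcal{B}(g)]=\langle\Psi(g)|\mathcal{B}^2|\Psi(g)\rangle-\langle\Psi(g)|\mathcal{B}|\Psi(g)\rangle^2$. Then the error-propagation uncertainty in estimating $g$ from $\langle\mathcal{B}(g)\rangle$ at the phase transition point $g=1$ has Heisenberg scaling: $$\left(\Delta g|_{\mathcal{B},g=1}\right)^2:=\frac{\mathrm{Var}[\mathcal{B}(g)]\big|_{g=1}}{\left[\frac{d}{dg}\langle\mathcal{B}(g)\rangle\big|_{g=1}\right]^2}=\Theta(N^{-2})\qquad (N=2^m\to\infty).$$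
   Context: Qubits are numbered $0,\dots,N-1$; $X_j,Y_j,Z_j$ are the Pauli matrices acting on qubit $j$, and $Z|0\rangle=|0\rangle$, $Z|1\rangle=-|1\rangle$. The Hamiltonian is $$H(J,B)=-J\sum_{j=0}^{N-1}X_jX_{j+1}-B\sum_{j=0}^{N-1}Z_j,$$ with Jordan-Wigner boundary conditions $X_N:=\widetilde Z X_0$, $\widetilde Z:=\bigotimes_{j=0}^{N-1}Z_j$. $H(J,B)$ commutes with $\widetilde Z$; the even-parity subspace is the $+1$ eigenspace of $\widetilde Z$. For $J>0$ and $B=gJ$ with $g>0$, $|\Psi(g)\rangle$ is the normalized eigenvector (unique up to phase) of lowest eigenvalue of $H(J,B)$ restricted to the even-parity subspace; up to phase it depends only on $g$. Majorana operators: $x_{2j}=Z_0\cdots Z_{j-1}X_j$, $x_{2j+1}=Z_0\cdots Z_{j-1}Y_j$ for $0\le j\le N-1$. Fermionic operators: $c_j=\frac12(x_{2j}+ix_{2j+1})$. Fourier modes: $b_j=\frac{1}{\sqrt N}\sum_{k=0}^{N-1}e^{-2\pi i jk/N}c_k$. $f(N)=\Theta(h(N))$ means that there are constants $0<C_1\le C_2$ with $C_1h(N)\le f(N)\le C_2h(N)$ for all sufficiently large $N$. *)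

(* Defs.v *)
From HB Require Import structures.
From mathcomp Require Import all_boot all_order all_algebra.
From mathcomp Require Import all_classical all_reals all_analysis.
From mathcomp.real_closed Require Export complex.

Set Implicit Arguments.
Unset Strict Implicit.
Unset Printing Implicit Defensive.

Import Order.TTheory GRing.Theory Num.Theory numFieldNormedType.Exports.

Local Open Scope ring_scope.
Local Open Scope complex_scope.
Local Open Scope sesquilinear_scope.

(* The computational basis of N qubits is indexed by bit strings
   s : {ffun 'I_N -> 'I_2}, enumerated in the order of enum_val. *)
Definition qdim (N : nat) : nat := #|{: {ffun 'I_N -> 'I_2}}|.
Definition bit (N : nat) (s : 'I_(qdim N)) (k : 'I_N) : 'I_2 :=
  (enum_val s : {ffun 'I_N -> 'I_2}) k.

Section Qubits.
Variable R : realType.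
Local Notation C := R[i].

Definition pauliX : 'M[C]_2 := \matrix_(a, b) (if a == b then 0 else 1).
Definition pauliY : 'M[C]_2 :=
  \matrix_(a, b) (if a == b then 0 else if a == 0 then - 'i%C else 'i%C).
Definition pauliZ : 'M[C]_2 :=
  \matrix_(a, b) (if a == b then (if a == 0 then 1 else - 1) else 0).

Variable N : nat.
Local Notation ket := 'cV[C]_(qdim N).
Local Notation op := 'M[C]_(qdim N).

(* The tensor product A_0 (x) ... (x) A_(N-1): its matrix element between the
   bit strings s and t is the product of the single-qubit matrix elements. *)
Definition tensor (A : 'I_N -> 'M[C]_2) : op :=
  \matrix_(s, t) \prod_(k < N) A k (bit s k) (bit t k).

Definition on_qubit (P : 'M[C]_2) (j : nat) : op :=
  tensor (fun k => if k == j :> nat then P else 1%:M).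

Definition Xq (j : nat) : op := on_qubit pauliX j.
Definition Yq (j : nat) : op := on_qubit pauliY j.
Definition Zq (j : nat) : op := on_qubit pauliZ j.
Definition Ztilde : op := tensor (fun=> pauliZ).

(* X_0, ..., X_(N-1) together with the boundary convention X_N := Z~ X_0. *)
Definition Xbc (j : nat) : op := if j == N then Ztilde *m Xq 0 else Xq j.

Definition hamiltonian (J B : R) : op :=
  - (J%:C *: \sum_(j < N) (Xbc j *m Xbc j.+1)) - B%:C *: \sum_(j < N) Zq j.

Definition even_eigenvector (J B E : R) (v : ket) : Prop :=
  [/\ v != 0, Ztilde *m v = v & hamiltonian J B *m v = E%:C *: v].

(* The eigenvalues of the Hermitian matrix hamiltonian J B are real, so it is
   enough to compare with real eigenvalues E'. *)
Definition even_ground_state (J B : R) (v : ket) : Prop :=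
  v^t* *m v = 1%:M /\
  exists E : R, even_eigenvector J B E v /\
    forall (E' : R) (w : ket), even_eigenvector J B E' w -> E <= E'.

Definition zstring (j : nat) : op := \big[mulmx/1%:M]_(i < j) Zq i.

(* majorana k is x_k, with k = 2j or k = 2j + 1. *)
Definition majorana (k : nat) : op :=
  zstring k./2 *m (if odd k then Yq k./2 else Xq k./2).

Definition cmode (j : nat) : op :=
  (2^-1 : C) *: (majorana j.*2 + 'i%C *: majorana j.*2.+1).

Definition cis (t : R) : C := cos t +i* sin t.

Definition bmode (j : nat) : op :=
  ((Num.sqrt N%:R)^-1)%:C *:
    \sum_(k < N) cis (- (2 * pi * (j * k)%:R / N%:R)) *: cmode k.

Definition occupation (j : nat) : op := (bmode j)^t* *m bmode j.

(* The real part is only a coercion to R: the expectation values below are those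
   of Hermitian operators. *)
Definition qexpectation (A : op) (v : ket) : R :=
  complex.Re ((v^t* *m A *m v) 0 0).

Definition qvariance (A : op) (v : ket) : R :=
  qexpectation (A *m A) v - qexpectation A v ^+ 2.

(* (Delta g | A, g = g0)^2 for the family of states Psi. *)
Definition sq_uncertainty (A : op) (Psi : R -> ket) (g0 : R) : R :=
  qvariance A (Psi g0) / ('D_1 (fun g : R => qexpectation A (Psi g)) g0) ^+ 2.

End Qubits.

Definition is_Theta (R : realType) (f h : nat -> R) : Prop :=
  exists C1 C2 : R, [/\ 0 < C1, C1 <= C2 &
    exists n0 : nat, forall n : nat, (n0 <= n)%N ->
      C1 * h n <= f n <= C2 * h n].

(* Main.v *)
Require Import Defs.
From mathcomp Require Import all_boot all_order all_algebra.
From mathcomp Require Import all_classical all_reals all_analysis.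
From mathcomp Require Import ring lra.
Import Order.TTheory GRing.Theory Num.Theory numFieldNormedType.Exports.
Local Open Scope complex_scope.
Local Open Scope sesquilinear_scope.
Local Open Scope ring_scope.

(* In terms of the Majorana operators the Hamiltonian, boundary term included,
   is a translation-invariant quadratic form. The commutator with it therefore
   acts on each pair P_k, Q_k of Fourier sums of the x_(2j) and the x_(2j+1) by
   a 2 x 2 matrix, diagonalized by eta_k = P_k + i w_k Q_k, where w_k is the
   phase of B - J e^(-ik). An even ground state is annihilated by eta_k and
   eta_(-k): otherwise applying b_0 or its adjoint as well, which costs less energy
   than eta_k gains, would give an even eigenvector of lower energy.
   With the anticommutation relations these two equations alone determine
   p = <b_1^* b_1> = (1 - Re w_k) / 2 for k = 2 pi / N, without diagonalizing
   the Hamiltonian. Since b_1^* b_1 is idempotent, its variance is p (1 - p), and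
   at g = 1 the squared uncertainty is exactly 4 tan(pi / N)^2. *)

(** * Pauli strings *)

Section Tensors.
Variable R : realType.
Local Notation C := R[i].
Local Notation X := (pauliX R).
Local Notation Y := (pauliY R).
Local Notation Z := (pauliZ R).

Ltac pauli := apply/matrixP => -[[|[|?]] ?] -[[|[|?]] ?] //;
  rewrite ?(mxE, big_ord_recl, big_ord0) /=;
  apply/eqP; rewrite eq_complex /=; apply/andP; split; apply/eqP; ring.

Lemma pauliXX : X *m X = 1%:M. Proof. pauli. Qed.
Lemma pauliYY : Y *m Y = 1%:M. Proof. pauli. Qed.
Lemma pauliZZ : Z *m Z = 1%:M. Proof. pauli. Qed.
Lemma pauliXY : X *m Y = 'i%C *: Z. Proof. pauli. Qed.
Lemma pauliYX : Y *m X = - 'i%C *: Z. Proof. pauli. Qed.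
Lemma pauliYZ : Y *m Z = 'i%C *: X. Proof. pauli. Qed.
Lemma pauliZY : Z *m Y = - 'i%C *: X. Proof. pauli. Qed.
Lemma pauliZX : Z *m X = 'i%C *: Y. Proof. pauli. Qed.
Lemma pauliXZ : X *m Z = - 'i%C *: Y. Proof. pauli. Qed.
Lemma pauliX_adj : X ^t* = X. Proof. pauli. Qed.
Lemma pauliY_adj : Y ^t* = Y. Proof. pauli. Qed.
Lemma pauliZ_adj : Z ^t* = Z. Proof. pauli. Qed.

Variable N : nat.

Lemma tensorM (A B : 'I_N -> 'M[C]_2) :
  tensor A *m tensor B = tensor (fun k => A k *m B k).
Proof.
apply/matrixP => s t; rewrite !mxE.
under [RHS]eq_bigr do rewrite mxE.
(* The product over sites of sums over one intermediate bit expands into a single sum over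
   intermediate bit strings. *)
rewrite bigA_distr_bigA (reindex (enum_val : 'I_(qdim N) -> _)) /=; last first.
  by apply: onW_bij; apply: enum_val_bij.
by apply: eq_bigr => u _; rewrite !mxE -big_split.
Qed.

Lemma eq_tensor (A B : 'I_N -> 'M[C]_2) : A =1 B -> tensor A = tensor B.
Proof.
by move=> eqAB; apply/matrixP => s t; rewrite !mxE; apply: eq_bigr => k _; rewrite eqAB.
Qed.

Lemma tensor_id (A : 'I_N -> 'M[C]_2) : (forall k, A k = 1%:M) -> tensor A = 1%:M.
Proof.
move=> A1; apply/matrixP => s t; rewrite !mxE.
under eq_bigr do rewrite A1 mxE.
have [->|nst] := eqVneq s t; first by rewrite big1 // => k _; rewrite eqxx.
have /existsP[k nk] : [exists k, bit s k != bit t k].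
  rewrite -negb_forall; apply: contra nst => /eqfunP eq_bits.
  by apply/eqP/enum_val_inj/ffunP.
by rewrite (bigD1 k) //= (negPf nk) mul0r.
Qed.

Lemma tensor_adj (A : 'I_N -> 'M[C]_2) : (tensor A) ^t* = tensor (fun k => (A k) ^t*).
Proof.
apply/matrixP => s t; rewrite !mxE rmorph_prod.
by apply: eq_bigr => k _; rewrite !mxE.
Qed.

(** This is multilinearity: a scalar at one site comes out of the tensor product. Below, every sign
    and every factor of i arises at a single site. *)
Lemma tensorZ (j : 'I_N) (c : C) (A B : 'I_N -> 'M[C]_2) :
    (forall k, A k = (if k == j then c else 1) *: B k) ->
  tensor A = c *: tensor B.
Proof.
move=> eqAB; apply/matrixP => s t; rewrite !mxE.
under eq_bigr do rewrite eqAB mxE.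
by rewrite big_split /= -big_mkcond big_pred1_eq.
Qed.

Lemma tensor_anticomm (j : 'I_N) (A B : 'I_N -> 'M[C]_2) :
    A j *m B j = - (B j *m A j) ->
    (forall k, k != j -> A k *m B k = B k *m A k) ->
  tensor A *m tensor B = - (tensor B *m tensor A).
Proof.
move=> ABj ABk; rewrite !tensorM -scaleN1r; apply: (@tensorZ j) => k.
by have [->|/ABk ->] := eqVneq k j; rewrite ?scaleN1r // scale1r.
Qed.

(** For [P] equal to X or Y this is a Majorana operator written as one tensor product, so that
    products can be computed site by site. *)
Definition jw (P : 'M[C]_2) (j : 'I_N) : 'M[C]_(qdim N) :=
  tensor (fun k => if (k < j)%N then Z else if k == j then P else 1%:M).

Lemma zstringE j : zstring R N j = tensor (fun k => if (k < j)%N then Z else 1%:M).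
Proof.
rewrite /zstring; elim: j => [|j IHj]; first by rewrite big_ord0 tensor_id.
rewrite -[LHS]/(\prod_(i < j.+1) Zq R N i) big_ord_recr /=.
rewrite -[X in X * _]/(\big[mulmx/1%:M]_(i < j) Zq R N i) IHj -[LHS]/(_ *m _) tensorM.
apply: eq_tensor => k; rewrite ltnS.
by case: ltngtP => //= _; rewrite ?mulmx1 ?mul1mx.
Qed.

Lemma zstring_on_qubit P (j : 'I_N) : zstring R N j *m on_qubit N P j = jw P j.
Proof.
rewrite zstringE tensorM; apply: eq_tensor => k; rewrite -(inj_eq val_inj) /=.
by case: ltngtP => //= _; rewrite ?mulmx1 ?mul1mx.
Qed.

Lemma majorana_even (j : 'I_N) : majorana R N j.*2 = jw X j.
Proof. by rewrite /majorana odd_double doubleK zstring_on_qubit. Qed.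

Lemma majorana_odd (j : 'I_N) : majorana R N j.*2.+1 = jw Y j.
Proof. by rewrite /majorana /= odd_double /= uphalf_double zstring_on_qubit. Qed.

Lemma jw_adj P j : P ^t* = P -> (jw P j) ^t* = jw P j.
Proof.
move=> PP; rewrite tensor_adj; apply: eq_tensor => k.
case: ifP => _; first exact: pauliZ_adj; case: ifP => // _.
by rewrite trmx1 map_mx1.
Qed.

Lemma jw_sqr P j : P *m P = 1%:M -> jw P j *m jw P j = 1%:M.
Proof.
move=> PP; rewrite tensorM; apply: tensor_id => k.
case: ifP => _; first exact: pauliZZ; case: ifP => // _.
by rewrite mulmx1.
Qed.

Lemma jw_anticomm_site P Q j : P *m Q = - (Q *m P) ->
  jw P j *m jw Q j = - (jw Q j *m jw P j).
Proof.
move=> PQ; apply: (@tensor_anticomm j); first by rewrite ltnn eqxx.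
by move=> k /negPf ->; case: ifP.
Qed.

(** Only site [j] yields a sign: there [P] meets a Z of the longer string. Below [j] both factors
    are Z, and above [j] the first is the identity. *)
Lemma jw_anticomm_lt P Q (j l : 'I_N) : P *m Z = - (Z *m P) -> (j < l)%N ->
  jw P j *m jw Q l = - (jw Q l *m jw P j).
Proof.
move=> PZ jl; apply: (@tensor_anticomm j); first by rewrite ltnn eqxx jl.
move=> k kj; rewrite (negPf kj).
have [kltj|] := ltnP k j; first by rewrite (ltn_trans kltj jl).
by move=> _; rewrite mulmx1 mul1mx.
Qed.

Lemma jw_anticomm P Q (j l : 'I_N) :
    P *m Z = - (Z *m P) -> Q *m Z = - (Z *m Q) -> j != l ->
  jw P j *m jw Q l = - (jw Q l *m jw P j).
Proof.
move=> PZ QZ; rewrite -(inj_eq val_inj) neq_ltn => /orP[] jl.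
  exact: jw_anticomm_lt.
by rewrite (jw_anticomm_lt _ _ l j) // opprK.
Qed.

Lemma jw_Ztilde P (j : 'I_N) : P *m Z = - (Z *m P) ->
  Ztilde R N *m jw P j = - (jw P j *m Ztilde R N).
Proof.
move=> PZ; apply: (@tensor_anticomm j); first by rewrite ltnn eqxx PZ opprK.
by move=> k /negPf ->; case: ifP => // _; rewrite mulmx1 mul1mx.
Qed.

Lemma Zq_jw (j : 'I_N) : Zq R N j = - 'i%C *: (jw X j *m jw Y j).
Proof.
rewrite tensorM; apply: (@tensorZ j) => k; rewrite -!(inj_eq val_inj) /=.
case: ltngtP => //= _; rewrite ?pauliZZ ?mulmx1 ?scale1r //.
by rewrite pauliXY scalerA mulNr -expr2 sqr_i opprK scale1r.
Qed.

Lemma XX_jw (j : 'I_N) : (1 < N)%N ->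
  Xbc R N j *m Xbc R N j.+1 = - 'i%C *: (jw Y j *m jw X (ordS j)).
Proof.
move=> N_gt1; have jN : (j == N :> nat) = false by rewrite ltn_eqF.
have Xj : X = - 'i%C *: (Y *m Z).
  by rewrite pauliYZ scalerA mulNr -expr2 sqr_i opprK scale1r.
rewrite /Xbc jN; have [jS|jS] := eqVneq j.+1 N.
  (* On the wrapping bond [jw X 0] is a bare X_0, and the factor [Ztilde] in X_N supplies exactly
     the string of [jw Y j], with XZ = -iY at site [j]. *)
  have S0 : ordS j = 0%N :> nat by rewrite /= jS modnn.
  have j0 : (j == 0%N :> nat) = false.
    by apply/eqP => j0; move: N_gt1; rewrite -jS j0.
  rewrite !tensorM; apply: (@tensorZ j) => k.
  cbv beta; rewrite S0 ltn0 -!(inj_eq val_inj) [val (ordS j)]S0 /=.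
  have [->|k0] := eqVneq (k : nat) 0%N.
    by rewrite eq_sym j0 lt0n j0 /= mul1mx scale1r.
  case: (ltngtP k j) => //= [_|jk|_]; rewrite ?mulmx1 ?mul1mx ?scale1r //.
    by have := leq_ltn_trans jk (ltn_ord k); rewrite jS ltnn.
  exact: pauliXZ.
(* On an inner bond the strings cancel below [j] and leave YZ = iX at site [j]. *)
have S1 : ordS j = j.+1 :> nat.
  by rewrite /= modn_small // ltn_neqAle jS ltn_ord.
rewrite !tensorM; apply: (@tensorZ j) => k.
cbv beta; rewrite S1 -!(inj_eq val_inj) [val (ordS j)]S1 /= ltnS.
case: (ltngtP k j) => //= [kj|jk|->];
  rewrite ?(ltn_eqF (leqW kj)) ?scale1r ?mulmx1 ?mul1mx ?pauliZZ //.
by rewrite (ltn_eqF (ltnSn j)) mulmx1.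
Qed.

End Tensors.

(** * Quadratic fermionic Hamiltonians *)

Section Fermions.
Variable R : realType.
Local Notation C := R[i].
Variable n : nat.
Local Notation op := 'M[C]_n.

Definition comm (A B : op) : op := A *m B - B *m A.
Definition acomm (A B : op) : op := A *m B + B *m A.

Lemma acommC A B : acomm A B = acomm B A.
Proof. by rewrite /acomm addrC. Qed.

(** Anticommutators of Majorana sums are scalars, so this makes the commutator of a quadratic form
    with a linear one linear again. *)
Lemma comm_mul A B D : comm (A *m B) D = A *m acomm B D - acomm A D *m B.
Proof.
rewrite /comm /acomm mulmxDr mulmxDl !mulmxA.
by rewrite opprD addrA addrK.
Qed.

Lemma comm_suml I (r : seq I) (F : I -> op) A :
  comm (\sum_(i <- r) F i) A = \sum_(i <- r) comm (F i) A.
Proof. by rewrite /comm mulmx_suml mulmx_sumr -sumrB. Qed.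

Lemma commDl A B D : comm (A + B) D = comm A D + comm B D.
Proof. by rewrite /comm mulmxDl mulmxDr opprD addrACA. Qed.

Lemma commDr A B D : comm D (A + B) = comm D A + comm D B.
Proof. by rewrite /comm mulmxDl mulmxDr opprD addrACA. Qed.

Lemma commZl c A B : comm (c *: A) B = c *: comm A B.
Proof. by rewrite /comm scalerBr -scalemxAl -scalemxAr. Qed.

Lemma commZr c A B : comm A (c *: B) = c *: comm A B.
Proof. by rewrite /comm scalerBr -scalemxAl -scalemxAr. Qed.

Lemma acommDr A B D : acomm D (A + B) = acomm D A + acomm D B.
Proof. by rewrite /acomm mulmxDl mulmxDr addrACA. Qed.

Lemma acommDl A B D : acomm (A + B) D = acomm A D + acomm B D.
Proof. by rewrite acommC acommDr 2!(acommC D). Qed.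

Lemma acommZr c A B : acomm A (c *: B) = c *: acomm A B.
Proof. by rewrite /acomm scalerDr -scalemxAl -scalemxAr. Qed.

Lemma acommZl c A B : acomm (c *: A) B = c *: acomm A B.
Proof. by rewrite acommC acommZr acommC. Qed.

Lemma acomm_self0 A : acomm A A = 0 -> A *m A = 0.
Proof.
rewrite /acomm -mulr2n -scaler_nat => /eqP.
by rewrite scaler_eq0 pnatr_eq0 => /eqP.
Qed.

Lemma mulmx_adj m1 m2 m3 (A : 'M[C]_(m1, m2)) (D : 'M[C]_(m2, m3)) :
  (A *m D) ^t* = D ^t* *m A ^t*.
Proof. by rewrite trmx_mul map_mxM. Qed.

Lemma addmx_adj m1 m2 (A D : 'M[C]_(m1, m2)) : (A + D) ^t* = A ^t* + D ^t*.
Proof. by rewrite linearD /= map_mxD. Qed.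

Lemma scalemx_adj m1 m2 c (A : 'M[C]_(m1, m2)) : (c *: A) ^t* = c^* *: A ^t*.
Proof. by rewrite linearZ /= map_mxZ. Qed.

(** Substituting b b^* = 1 - b^* b in the middle leaves b^* b minus a term containing b b = 0. *)
Lemma number_idempotent (b : op) :
    acomm b b = 0 -> acomm b (b ^t*) = 1%:M ->
  (b ^t* *m b) *m (b ^t* *m b) = b ^t* *m b.
Proof.
rewrite {2}/acomm => /acomm_self0 bb /eqP; rewrite eq_sym -subr_eq => /eqP bbt.
rewrite -mulmxA (mulmxA b) -bbt mulmxBl mulmxBr mul1mx -mulmxA bb.
by rewrite !mulmx0 subr0.
Qed.

Definition sqnorm (u : 'cV[C]_n) : C := (u ^t* *m u) 0 0.

Lemma sqnormZ c u : sqnorm (c *: u) = c * c^* * sqnorm u.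
Proof.
by rewrite /sqnorm scalemx_adj -scalemxAl -scalemxAr scalerA mxE [c^* * c]mulrC.
Qed.

(** * Linear combinations of Majorana operators *)

Variable N : nat.

Definition smear (x : 'I_N -> op) (f : 'I_N -> C) : op := \sum_j f j *: x j.

Lemma acomm_smearr A x f : acomm A (smear x f) = \sum_j f j *: acomm A (x j).
Proof.
rewrite /acomm mulmx_suml mulmx_sumr -big_split /=; apply: eq_bigr => j _.
by rewrite scalerDr -scalemxAl -scalemxAr.
Qed.

Lemma acomm_smearl A x f : acomm (smear x f) A = \sum_j f j *: acomm (x j) A.
Proof.
rewrite acommC acomm_smearr.
by under eq_bigr do rewrite acommC.
Qed.

Lemma smear_adj x f : (forall j, (x j) ^t* = x j) ->
  (smear x f) ^t* = smear x (fun j => (f j)^*).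
Proof.
move=> xx; rewrite /smear raddf_sum raddf_sum; apply: eq_bigr => j _ /=.
by rewrite linearZ /= map_mxZ xx.
Qed.

Variables p q : 'I_N -> op.
Hypothesis acomm_pp : forall i j, acomm (p i) (p j) = (if i == j then 2 else 0)%:M.
Hypothesis acomm_qq : forall i j, acomm (q i) (q j) = (if i == j then 2 else 0)%:M.
Hypothesis acomm_pq : forall i j, acomm (p i) (q j) = 0.

Local Notation P := (smear p).
Local Notation Q := (smear q).

Lemma acomm_p_smear i f : acomm (p i) (P f) = (2 * f i)%:M.
Proof.
rewrite acomm_smearr (bigD1 i) //= acomm_pp eqxx big1 => [|j /negPf ji].
  by rewrite addr0 scale_scalar_mx mulrC.
by rewrite acomm_pp eq_sym ji scale_scalar_mx mulr0 raddf0.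
Qed.

Lemma acomm_q_smear i f : acomm (q i) (Q f) = (2 * f i)%:M.
Proof.
rewrite acomm_smearr (bigD1 i) //= acomm_qq eqxx big1 => [|j /negPf ji].
  by rewrite addr0 scale_scalar_mx mulrC.
by rewrite acomm_qq eq_sym ji scale_scalar_mx mulr0 raddf0.
Qed.

Lemma acomm_p_smearq i f : acomm (p i) (Q f) = 0.
Proof. by rewrite acomm_smearr big1 // => j _; rewrite acomm_pq scaler0. Qed.

Lemma acomm_q_smearp i f : acomm (q i) (P f) = 0.
Proof. by rewrite acomm_smearr big1 // => j _; rewrite acommC acomm_pq scaler0. Qed.

Lemma acomm_smearpp f g : acomm (P f) (P g) = (2 * \sum_j f j * g j)%:M.
Proof.
rewrite acomm_smearl mulr_sumr raddf_sum; apply: eq_bigr => j _ /=.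
by rewrite acomm_p_smear scale_scalar_mx mulrCA.
Qed.

Lemma acomm_smearqq f g : acomm (Q f) (Q g) = (2 * \sum_j f j * g j)%:M.
Proof.
rewrite acomm_smearl mulr_sumr raddf_sum; apply: eq_bigr => j _ /=.
by rewrite acomm_q_smear scale_scalar_mx mulrCA.
Qed.

Lemma acomm_smearpq f g : acomm (P f) (Q g) = 0.
Proof.
by rewrite acomm_smearl big1 // => j _; rewrite acomm_p_smearq scaler0.
Qed.

Variables J B : R.

(** Here [p j] and [q j] stand for x_(2j) and x_(2j+1), and [ordS] includes the boundary bond. The
    factors of i come from X_j X_(j+1) = -i q_j p_(j+1) and Z_j = -i p_j q_j. *)
Definition quadH : op :=
  ('i%C * J%:C) *: (\sum_j q j *m p (ordS j)) + ('i%C * B%:C) *: (\sum_j p j *m q j).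

(* For the momentum k, o and o' are e^(-ik) and e^(ik), w and w' are the phases
   of B - J e^(-ik) and of its conjugate, and r is their common modulus. *)
Section Mode.
Variables (f : 'I_N -> C) (o o' : C).
Hypotheses (fS : forall j, f (ordS j) = o * f j) (oo' : o * o' = 1).

(** Only the [p] factor of each term contributes. In the bond terms it sits one site further than
    [q], whence the phase [o]. *)
Lemma comm_quadH_P : comm quadH (P f) = (- 2 * 'i%C * (B%:C - J%:C * o)) *: Q f.
Proof.
rewrite commDl !commZl !comm_suml.
have -> : \sum_j comm (q j *m p (ordS j)) (P f) = (2 * o) *: Q f.
  rewrite scaler_sumr; apply: eq_bigr => j _.
  rewrite comm_mul acomm_q_smearp mul0mx subr0 acomm_p_smear fS mul_mx_scalar.
  by rewrite scalerA mulrA.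
have -> : \sum_j comm (p j *m q j) (P f) = (- 2) *: Q f.
  rewrite scaler_sumr; apply: eq_bigr => j _.
  rewrite comm_mul acomm_q_smearp mulmx0 sub0r acomm_p_smear mul_scalar_mx.
  by rewrite scalerA mulNr scaleNr.
by rewrite !scalerA -scalerDl; congr (_ *: _); ring.
Qed.

Lemma comm_quadH_Q : comm quadH (Q f) = (2 * 'i%C * (B%:C - J%:C * o')) *: P f.
Proof.
rewrite commDl !commZl !comm_suml.
have -> : \sum_j comm (q j *m p (ordS j)) (Q f) = (- 2 * o') *: P f.
  (* The surviving operator is [p (ordS j)] with coefficient [f j], which equals
     [o' * f (ordS j)]. *)
  rewrite scaler_sumr [RHS](reindex (@ordS N)) /=; last by apply/onW_bij/ordS_bij.
  apply: eq_bigr => j _.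
  rewrite comm_mul acomm_p_smearq mulmx0 sub0r acomm_q_smear mul_scalar_mx fS.
  rewrite scalerA -scaleNr; congr (_ *: _).
  have -> : - 2 * o' * (o * f j) = - 2 * (o * o') * f j by ring.
  by rewrite oo'; ring.
have -> : \sum_j comm (p j *m q j) (Q f) = 2 *: P f.
  rewrite scaler_sumr; apply: eq_bigr => j _.
  rewrite comm_mul acomm_p_smearq mul0mx subr0 acomm_q_smear mul_mx_scalar.
  by rewrite scalerA.
by rewrite !scalerA -scalerDl; congr (_ *: _); ring.
Qed.

(** On the span of [P f] and [Q f] the commutator is off-diagonal with entries of product 4r^2, so
    its eigenvalues are 2r and -2r; this is the energy-lowering eigenvector. *)
Lemma comm_quadH_bogoliubov (w w' r : C) :
    w * r = B%:C - J%:C * o -> w' * r = B%:C - J%:C * o' -> w * w' = 1 ->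
  comm quadH (P f + ('i%C * w) *: Q f) = (- 2 * r) *: (P f + ('i%C * w) *: Q f).
Proof.
move=> wr w'r ww'.
rewrite commDr commZr comm_quadH_P comm_quadH_Q -wr -w'r scalerA scalerDr scalerA.
rewrite addrC; congr (_ *: _ + _ *: _); last by ring.
have -> : 'i%C * w * (2 * 'i%C * (w' * r)) = 2 * ('i%C ^+ 2) * (w * w') * r :> C by ring.
by rewrite sqr_i ww'; ring.
Qed.

End Mode.

Variable T : op.
Hypotheses (Tp : forall j, T *m p j = - (p j *m T))
           (Tq : forall j, T *m q j = - (q j *m T)).

Lemma parity_smear x f : (forall j, T *m x j = - (x j *m T)) ->
  T *m smear x f = - (smear x f *m T).
Proof.
move=> Tx; rewrite mulmx_sumr mulmx_suml -sumrN; apply: eq_bigr => j _.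
by rewrite -scalemxAr Tx -scalemxAl scalerN.
Qed.

Lemma comm_eigen (H A : op) (u : 'cV[C]_n) (E a : C) :
  comm H A = a *: A -> H *m u = E *: u -> H *m (A *m u) = (E + a) *: (A *m u).
Proof.
move=> /eqP; rewrite subr_eq => /eqP HA Hu.
by rewrite mulmxA HA mulmxDl -scalemxAl -mulmxA Hu -scalemxAr scalerDl addrC.
Qed.

Section GroundState.
Variables (v : 'cV[C]_n) (E : R).
Hypotheses (N_gt0 : (0 < N)%N) (Tv : T *m v = v) (Hv : quadH *m v = E%:C *: v).
Hypothesis min_E : forall (E' : R) (u : 'cV[C]_n), u != 0 -> T *m u = u ->
  quadH *m u = E'%:C *: u -> E <= E'.

(* The Bogoliubov mode lowers the energy by 2r but flips the parity; multiplying
   by either zero-momentum mode restores the parity at a cost 2(B - J) of either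
   sign. Both products kill v by minimality, and the zero-momentum modes together
   span P 1, whose square is N. *)
Lemma bogoliubov_kills (f : 'I_N -> C) (o o' w w' : C) (r : R) :
    (forall j, f (ordS j) = o * f j) -> o * o' = 1 ->
    w * r%:C = B%:C - J%:C * o -> w' * r%:C = B%:C - J%:C * o' -> w * w' = 1 ->
    `|B - J| < r ->
  (P f + ('i%C * w) *: Q f) *m v = 0.
Proof.
move=> fS oo' wr w'r ww' r_gt.
set eta := P f + _.
have Heta : quadH *m (eta *m v) = (E%:C + - 2 * r%:C) *: (eta *m v).
  by apply: comm_eigen => //; apply: comm_quadH_bogoliubov wr w'r ww'.
have Teta : T *m (eta *m v) = - (eta *m v).
  rewrite mulmxA mulmxDr -scalemxAr !parity_smear // scalerN -opprD.
  by rewrite scalemxAl -mulmxDl mulNmx -mulmxA Tv.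
pose one := fun _ : 'I_N => 1 : C.
have oneS j : one (ordS j) = 1 * one j by rewrite mul1r.
(* At zero momentum [o] and [o'] are 1, so [comm_quadH_bogoliubov] applies with [w] and [w'] equal
   to [s] and with [s * (B - J)] as the signed modulus. *)
have kill (s : R) : s ^+ 2 = 1 ->
    (P one + ('i%C * s%:C) *: Q one) *m (eta *m v) = 0.
  move=> s2; apply/eqP/negPn/negP => u_neq0.
  pose E' := E + - 2 * r + - 2 * (s * (B - J)).
  (* Minimality would give this inequality, but the net energy change is at most 2 |B - J| - 2r,
     which is negative. *)
  suff : E <= E'.
    have : `|s * (B - J)| < r.
      by rewrite normrM -(sqrtr_sqr s) s2 sqrtr1 mul1r.
    by rewrite ltr_norml /E' => /andP[]; lra.
  apply: min_E u_neq0 _ _.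
    rewrite mulmxA mulmxDr -scalemxAr !parity_smear // scalerN -opprD.
    by rewrite scalemxAl -mulmxDl mulNmx -mulmxA Teta mulmxN opprK.
  have -> : E'%:C = (E%:C + - 2 * r%:C) + (- 2 * (s%:C * (B%:C - J%:C))).
    by rewrite /E' !(rmorphD, rmorphM, rmorphN, rmorphB, rmorph_nat).
  have ss : s%:C * s%:C = 1 by rewrite -rmorphM -expr2 s2 rmorph1.
  apply: comm_eigen => //.
  apply: (@comm_quadH_bogoliubov one 1 1 oneS _ s%:C s%:C) => //.
  - by rewrite mulr1.
  - by rewrite mulrA ss mul1r mulr1.
  - by rewrite mulrA ss mul1r mulr1.
have kp := kill 1 (expr1n _ _).
have kn := kill (-1) (sqrr_sign _ 1).
(* Adding the cases [s] = 1 and [s] = -1 cancels the [Q one] terms. *)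
have P1eta : P one *m (eta *m v) = 0.
  have : P one *m (eta *m v) + P one *m (eta *m v) = 0.
    move: (congr2 (fun a b => a + b) kp kn); rewrite !mulmxDl addr0 addrACA.
    rewrite rmorphN rmorph1 mulr1 mulrN1 scaleNr mulNmx subrr addr0; by apply.
  by rewrite -mulr2n -scaler_nat => /eqP; rewrite scaler_eq0 pnatr_eq0 => /eqP.
have : acomm (P one) (P one) *m (eta *m v) = 0.
  by rewrite mulmxDl -!mulmxA P1eta mulmx0 addr0.
rewrite acomm_smearpp mul_scalar_mx => /eqP; rewrite scaler_eq0 => /orP[|/eqP //].
under eq_bigr do rewrite mulr1.
by rewrite sumr_const card_ord mulf_eq0 !pnatr_eq0 (gtn_eqF N_gt0).
Qed.

End GroundState.

(** * Occupation numbers in the ground state *)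

Hypotheses (p_adj : forall j, (p j) ^t* = p j) (q_adj : forall j, (q j) ^t* = q j).

(* Half filling of the Q modes, from {P, Q^*} = 0 and {Q, Q^*} = 2N. *)
Lemma sqnorm_Q (v : 'cV[C]_n) (f : 'I_N -> C) (w : C) :
    v ^t* *m v = 1%:M -> (forall j, f j * (f j)^* = 1) -> w * w^* = 1 ->
    (P f + ('i%C * w) *: Q f) *m v = 0 ->
    (P (fun j => (f j)^*) + ('i%C * w^*) *: Q (fun j => (f j)^*)) *m v = 0 ->
  sqnorm (Q f *m v) = N%:R.
Proof.
move=> vv ff ww.
set fc := fun j => _.
move=> /eqP; rewrite mulmxDl addr_eq0 => /eqP Pv.
move=> /eqP; rewrite mulmxDl addr_eq0 => /eqP Pcv.
have Qadj : (Q f) ^t* = Q fc by exact: smear_adj.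
have Qcadj : (Q fc) ^t* = Q f by rewrite -Qadj trmxCK.
have Pcadj : (P fc) ^t* = P f by rewrite -[P fc]smear_adj // trmxCK.
have sumN : sqnorm (Q f *m v) + sqnorm (Q fc *m v) = 2 * N%:R.
  rewrite /sqnorm !mulmx_adj Qadj Qcadj.
  have := acomm_smearqq fc f => /(congr1 (fun A => (v ^t* *m A *m v) 0 0)).
  rewrite /acomm mulmxDr mulmxDl mxE !mulmxA => ->.
  rewrite mul_mx_scalar -scalemxAl vv mxE mxE mulr1.
  by under eq_bigr do rewrite mulrC ff; rewrite sumr_const card_ord.
have i_neq0 : 'i%C != 0 :> C by rewrite eq_complex /= oner_eq0 andbF.
have w_neq0 : w != 0.
  by apply/eqP => w0; move: ww; rewrite w0 mul0r; apply/eqP; rewrite eq_sym oner_neq0.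
have iw_neq0 : 'i%C * w != 0 := mulf_neq0 i_neq0 w_neq0.
(* In the expectation of {P, Q^*} = 0, the annihilation equation at -k rewrites [P f] acting to the
   left and the one at k rewrites it acting to the right. The two terms are i w times the two norms,
   with opposite signs. *)
have eqN : sqnorm (Q f *m v) = sqnorm (Q fc *m v).
  have := acomm_smearpq f fc => /(congr1 (fun A => (v ^t* *m A *m v) 0 0)).
  rewrite /acomm mulmxDr mulmxDl mxE mulmx0 mul0mx [in RHS]mxE.
  have vP : v ^t* *m P f = ('i%C * w) *: (Q fc *m v) ^t*.
    rewrite -Pcadj -mulmx_adj Pcv -scalemxAl -scaleNr scalemx_adj; congr (_ *: _).
    rewrite rmorphN rmorphM /= conjCK -mulNr; congr (_ * _).
    by apply/eqP; rewrite eq_complex /= oppr0 opprK !eqxx.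
  have vQ : v ^t* *m Q fc = (Q f *m v) ^t* by rewrite mulmx_adj Qadj.
  rewrite !mulmxA vP vQ -2!mulmxA Pv mulmxN -!scalemxAl -scalemxAr.
  rewrite mxE [X in _ + X]mxE [X in _ - X]mxE => sum0.
  exact: esym (mulfI iw_neq0 (subr0_eq sum0)).
have -> : sqnorm (Q f *m v) = (sqnorm (Q f *m v) + sqnorm (Q fc *m v)) / 2.
  by rewrite -eqN; field.
by rewrite sumN; field.
Qed.

Section Number.
Variables (c : C) (f : 'I_N -> C).
Hypotheses (ff : forall j, f j * (f j)^* = 1) (c_norm : c * c^* * (4 * N%:R) = 1).

Definition fmode : op := c *: (P f + 'i%C *: Q f).

Lemma conj_i : Num.conj ('i%C : C) = - 'i%C.
Proof. by apply/eqP; rewrite eq_complex /= oppr0 !eqxx. Qed.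

Lemma fmode_adj : fmode ^t* =
  c^* *: (P (fun j => (f j)^*) - 'i%C *: Q (fun j => (f j)^*)).
Proof.
by rewrite scalemx_adj addmx_adj scalemx_adj !smear_adj // conj_i scaleNr.
Qed.

(** The cross terms vanish, and {P, P} and i^2 {Q, Q} cancel because both families have the same
    anticommutators. *)
Lemma fmode_acomm0 : acomm fmode fmode = 0.
Proof.
rewrite acommZl acommZr !acommDl !acommDr !acommZl !acommZr acommC.
rewrite (acommC (Q f) (P f)) acomm_smearpq !scaler0 add0r addr0.
rewrite (scalerA 'i%C) -expr2 sqr_i acomm_smearpp acomm_smearqq scaleN1r subrr.
by rewrite !scaler0.
Qed.

(** With the adjoint the two contributions of 2N add instead of cancelling; [c_norm] normalizes the
    total 4N. *)
Lemma fmode_acomm_adj : acomm fmode (fmode ^t*) = 1%:M.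
Proof.
rewrite fmode_adj acommZl acommZr !acommDl !acommDr -!scaleNr !acommZl !acommZr.
rewrite (acommC (Q f) (P _)) !acomm_smearpq !scaler0 add0r addr0.
rewrite (scalerA 'i%C) acomm_smearpp acomm_smearqq mulrN -expr2 sqr_i opprK scale1r.
under eq_bigr do rewrite ff; rewrite sumr_const card_ord.
rewrite -raddfD /= scalerA scale_scalar_mx.
transitivity ((c * c^* * (4 * N%:R))%:M : op); last by rewrite c_norm.
by congr (_%:M); ring.
Qed.

(** Since P v = -i w Q v, the mode acts on [v] as c i (1 - w) Q. Its squared norm is |c|^2 |1 - w|^2
    N, that is |1 - w|^2 / 4. *)
Lemma mean_number (v : 'cV[C]_n) (w : C) :
    v ^t* *m v = 1%:M -> w * w^* = 1 ->
    (P f + ('i%C * w) *: Q f) *m v = 0 ->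
    (P (fun j => (f j)^*) + ('i%C * w^*) *: Q (fun j => (f j)^*)) *m v = 0 ->
  (v ^t* *m (fmode ^t* *m fmode) *m v) 0 0 = (2 - (w + w^*)) / 4.
Proof.
move=> vv ww Pv Pcv.
have QN := sqnorm_Q _ _ _ vv ff ww Pv Pcv.
have bv : fmode *m v = (c * ('i%C * (1 - w))) *: (Q f *m v).
  rewrite -scalemxAl -scalerA; congr (_ *: _).
  have -> : P f + 'i%C *: Q f = (P f + ('i%C * w) *: Q f) + ('i%C * (1 - w)) *: Q f.
    by rewrite -addrA -scalerDl; congr (_ + _ *: _); ring.
  by rewrite mulmxDl Pv add0r -scalemxAl.
have -> : v ^t* *m (fmode ^t* *m fmode) *m v = (fmode *m v) ^t* *m (fmode *m v).
  by rewrite mulmx_adj !mulmxA.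
rewrite -/(sqnorm _) bv sqnormZ QN !rmorphM rmorphB rmorph1 /= conj_i.
have -> : 4^-1 = c * c^* * N%:R.
  have -> : c * c^* * N%:R = c * c^* * (4 * N%:R) / 4 by field.
  by rewrite c_norm mul1r.
transitivity (- ('i%C ^+ 2) * (1 - (w + w^*) + w * w^*) * (c * c^* * N%:R)).
  by ring.
by rewrite sqr_i ww; ring.
Qed.

End Number.

End Fermions.

(** * The Ising chain *)

Section Ising.
Variable R : realType.
Local Notation C := R[i].
Variable N : nat.
Local Notation px := (@jw R N (pauliX R)).
Local Notation qy := (@jw R N (pauliY R)).

Lemma pauliX_anti_Z : pauliX R *m pauliZ R = - (pauliZ R *m pauliX R).
Proof. by rewrite pauliXZ pauliZX scaleNr. Qed.

Lemma pauliY_anti_Z : pauliY R *m pauliZ R = - (pauliZ R *m pauliY R).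
Proof. by rewrite pauliYZ pauliZY scaleNr opprK. Qed.

Lemma pauliX_anti_Y : pauliX R *m pauliY R = - (pauliY R *m pauliX R).
Proof. by rewrite pauliXY pauliYX scaleNr opprK. Qed.

Lemma jw_acomm (P : 'M[C]_2) (i j : 'I_N) :
    P *m P = 1%:M -> P *m pauliZ R = - (pauliZ R *m P) ->
  acomm R _ (jw R N P i) (jw R N P j) = (if i == j then 2 else 0)%:M.
Proof.
move=> PP PZ; rewrite /acomm; have [->|ij] := eqVneq i j.
  by rewrite jw_sqr // -raddfD.
by rewrite (jw_anticomm R N P P i j) // addNr raddf0.
Qed.

Lemma jw_acommXY (i j : 'I_N) : acomm R _ (px i) (qy j) = 0.
Proof.
apply/eqP; rewrite addr_eq0; apply/eqP; have [->|ij] := eqVneq i j.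
  exact/jw_anticomm_site/pauliX_anti_Y.
by apply: jw_anticomm ij; [exact: pauliX_anti_Z|exact: pauliY_anti_Z].
Qed.

Lemma hamiltonian_quadH (J B : R) : (1 < N)%N ->
  hamiltonian N J B = quadH R _ N px qy J B.
Proof.
move=> N_gt1; rewrite /hamiltonian /quadH.
under eq_bigr do rewrite XX_jw //.
under [X in _ - _ *: X]eq_bigr do rewrite Zq_jw.
by rewrite -!scaler_sumr !scalerA -!scaleNr; congr (_ *: _ + _ *: _); ring.
Qed.

Lemma conj_real (x : R) : (x%:C)^* = x%:C.
Proof. exact: conjc_real. Qed.

Lemma cisD (a b : R) : cis (a + b) = cis a * cis b.
Proof.
by apply/eqP; rewrite eq_complex /= sinD cosD [sin a * _ + _]addrC !eqxx.
Qed.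

Lemma cis_conj (a : R) : (cis a)^* = cis (- a).
Proof. by apply/eqP; rewrite eq_complex /= sinN cosN !eqxx. Qed.

Lemma cis0 : cis 0 = 1 :> C.
Proof. by apply/eqP; rewrite eq_complex /= sin0 cos0 !eqxx. Qed.

Lemma cis_norm (a : R) : cis a * (cis a)^* = 1.
Proof. by rewrite cis_conj -cisD subrr cis0. Qed.

Lemma cis_2pi : cis (- (2 * pi)) = 1 :> C.
Proof.
by apply/eqP; rewrite eq_complex /= sinN cosN mulr_natl cos2pi sin2pi oppr0 !eqxx.
Qed.

(** The factor [1 * k] is kept so that this matches the coefficients of [bmode R N 1] by
    conversion. *)
Definition wave (k : 'I_N) : C := cis (- (2 * pi * (1 * k)%:R / N%:R)).

Lemma wave_ordS (k : 'I_N) : (0 < N)%N ->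
  wave (ordS k) = cis (- (2 * pi / N%:R)) * wave k.
Proof.
move=> N_gt0; have N0 : N%:R != 0 :> R by rewrite pnatr_eq0 -lt0n.
rewrite -cisD /wave !mul1n; have [kN|kN] := eqVneq k.+1 N.
  (* At the last site the successor is 0, and the accumulated phase is a full turn. *)
  rewrite /= kN modnn mulr0 mul0r oppr0 cis0.
  transitivity (cis (- (2 * pi)) : C); first by rewrite cis_2pi.
  congr (cis _).
  have -> : (k : nat)%:R = N%:R - 1 :> R by rewrite -[N in RHS]kN -natr1 addrK.
  by field.
have kS : (k.+1 < N)%N by rewrite ltn_neqAle kN ltn_ord.
by rewrite /= modn_small //; congr (cis _); rewrite -natr1; field.
Qed.

Lemma bmode_fmode : (0 < N)%N ->
  bmode R N 1 = fmode R _ N px qy (((Num.sqrt N%:R)^-1)%:C / 2) wave.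
Proof.
move=> N_gt0; rewrite /bmode /fmode -scalerA; congr (_ *: _).
rewrite !scaler_sumr -big_split /= scaler_sumr; apply: eq_bigr => k _.
rewrite /cmode majorana_even majorana_odd -/(wave k) !scalerA scalerDr !scalerA.
by rewrite scalerDr !scalerA; congr (_ *: _ + _ *: _); ring.
Qed.

Lemma fmode_norm : (0 < N)%N ->
  let c := ((Num.sqrt (N%:R : R))^-1)%:C / 2 in c * c^* * (4 * N%:R) = 1.
Proof.
move=> N_gt0 c.
have cc : c^* = c.
  by rewrite /c rmorphM /= conj_real; congr (_ * _); rewrite fmorphV rmorph_nat.
rewrite cc /c.
have N0 : N%:R != 0 :> C by rewrite pnatr_eq0 -lt0n.
have : ((Num.sqrt (N%:R : R))^-1)%:C ^+ 2 = N%:R^-1.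
  by rewrite -rmorphXn /= exprVn sqr_sqrtr ?ler0n // fmorphV rmorph_nat.
move: (_%:C) => s s2; transitivity (s ^+ 2 * N%:R); first by field.
by rewrite s2 mulVf.
Qed.

Lemma occupation_idempotent : (0 < N)%N ->
  occupation R N 1 *m occupation R N 1 = occupation R N 1.
Proof.
move=> N_gt0; rewrite /occupation (bmode_fmode N_gt0).
have XX i j := jw_acomm (pauliX R) i j (pauliXX R) pauliX_anti_Z.
have YY i j := jw_acomm (pauliY R) i j (pauliYY R) pauliY_anti_Z.
apply: number_idempotent.
  exact: (@fmode_acomm0 R _ N px qy XX YY jw_acommXY).
apply: (@fmode_acomm_adj R _ N px qy XX YY jw_acommXY).
- by move=> j; apply/jw_adj/pauliX_adj.
- by move=> j; apply/jw_adj/pauliY_adj.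
- by move=> j; apply: cis_norm.
- exact: fmode_norm.
Qed.

(** With c = cos k this is |g - e^(-ik)|, the excitation energy of momentum k in units of 2J. *)
Definition dispersion (g c : R) : R := Num.sqrt (1 + g ^+ 2 - 2 * g * c).

(** The squares differ by 2 g (1 - c). Multiplied by [J], this is the energy condition of
    [bogoliubov_kills]. *)
Lemma dispersion_gt (g c : R) : 0 < g -> c < 1 -> `|g - 1| < dispersion g c.
Proof.
move=> g_gt0 c_lt1; have gc : 0 < g * (1 - c) by rewrite mulr_gt0 // subr_gt0.
have lt_sq : (g - 1) ^+ 2 < 1 + g ^+ 2 - 2 * g * c by lra.
by rewrite -sqrtr_sqr ltr_sqrt // (le_lt_trans (sqr_ge0 _) lt_sq).
Qed.

Lemma cos_wave_lt1 : (2 < N)%N -> cos (2 * pi / N%:R : R) < 1.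
Proof.
move=> N_gt2; have N_ge2 : 2 <= N%:R :> R by rewrite ler_nat ltnW.
have N_gt0 : 0 < N%:R :> R by apply: lt_le_trans N_ge2.
have pi0 := pi_gt0 R.
have t_gt0 : 0 < 2 * pi / N%:R :> R by rewrite divr_gt0 // mulr_gt0.
have t_le : 2 * pi / N%:R <= pi :> R by rewrite ler_pdivrMr // mulrC ler_pM2l.
by rewrite -[ltRHS](@cos0 R) ltr_cos ?in_itv /= ?lexx ?pi_ge0 ?(ltW t_gt0) ?t_le.
Qed.

Lemma mean_occupation (J g : R) (v : 'cV[C]_(qdim N)) :
    (2 < N)%N -> 0 < J -> 0 < g -> even_ground_state J (g * J) v ->
  let c := cos (2 * pi / N%:R) in
  qexpectation (occupation R N 1) v = (1 - (g - c) / dispersion g c) / 2.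
Proof.
move=> N_gt2 J_gt0 g_gt0 [vv [E [[v_neq0 Zv Hv] minE]]] c.
have N_gt1 := ltnW N_gt2; have N_gt0 := ltnW N_gt1.
have XX i j := jw_acomm (pauliX R) i j (pauliXX R) pauliX_anti_Z.
have YY i j := jw_acomm (pauliY R) i j (pauliYY R) pauliY_anti_Z.
have ZX j := jw_Ztilde R N (pauliX R) j pauliX_anti_Z.
have ZY j := jw_Ztilde R N (pauliY R) j pauliY_anti_Z.
have hamE := hamiltonian_quadH J (g * J) N_gt1.
have c_lt1 : c < 1 by exact: cos_wave_lt1.
have d_gt : `|g - 1| < dispersion g c by exact: dispersion_gt.
have d_gt0 : 0 < dispersion g c by apply: le_lt_trans d_gt.
set d := dispersion g c in d_gt d_gt0 *.
have d2 : d ^+ 2 = 1 + g ^+ 2 - 2 * g * c.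
  by rewrite sqr_sqrtr // ltW // -sqrtr_gt0.
set o : C := cis (- (2 * pi / N%:R)).
have oo : o * o^* = 1 by exact: cis_norm.
have o_re : o + o^* = (2 * c)%:C.
  apply/eqP; rewrite cis_conj opprK eq_complex /= cosN sinN addNr eqxx andbT.
  by apply/eqP; rewrite -/c; ring.
(* The phase of g - e^(-ik); the common factor [J] of B - J e^(-ik) goes into the modulus
   [J * d]. *)
pose w : C := (g%:C - o) / d%:C.
have d_neq0 : d%:C != 0 by rewrite fmorph_eq0 gt_eqF.
have wd : w * (J * d)%:C = (g * J)%:C - J%:C * o.
  by rewrite !rmorphM /w; field.
have w'E : w^* = (g%:C - o^*) / d%:C.
  by rewrite fmorph_div rmorphB /= !conj_real.
have wd' : w^* * (J * d)%:C = (g * J)%:C - J%:C * o^*.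
  by rewrite w'E !rmorphM; field.
have ww : w * w^* = 1.
  have dd : d%:C ^+ 2 = 1 + g%:C ^+ 2 - g%:C * (o + o^*).
    by rewrite o_re -rmorphXn d2 !(rmorphD, rmorphN, rmorphM, rmorphXn, rmorph1) /=; ring.
  rewrite w'E /w; apply: (mulIf (expf_neq0 2 d_neq0)).
  rewrite mul1r; transitivity ((g%:C - o) * (g%:C - o^*)); first by field.
  have -> : (g%:C - o) * (g%:C - o^*) = o * o^* + g%:C ^+ 2 - g%:C * (o + o^*) by ring.
  by rewrite oo dd.
have r_gt : `|g * J - J| < J * d.
  have -> : g * J - J = J * (g - 1) by ring.
  by rewrite normrM gtr0_norm // ltr_pM2l.
have minE' (E' : R) (u : 'cV[C]_(qdim N)) : u != 0 -> Ztilde R N *m u = u ->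
    quadH R _ N px qy J (g * J) *m u = E'%:C *: u -> E <= E'.
  by move=> u0 Zu Hu; apply: (minE E' u); split=> //; rewrite hamE.
rewrite hamE in Hv.
have kills := @bogoliubov_kills R _ N px qy XX YY jw_acommXY J (g * J)
  (Ztilde R N) ZX ZY v E N_gt0 Zv Hv minE'.
have ww' : w^* * w = 1 by rewrite mulrC.
have oo' : o^* * o = 1 by rewrite mulrC.
have wave_conjS k : (wave (ordS k))^* = o^* * (wave k)^*.
  by rewrite wave_ordS // rmorphM.
(* The wave and its conjugate have momenta k and -k; passing to -k exchanges [o] with its conjugate
   and [w] with its conjugate. *)
have Pv := kills _ _ _ _ _ _ (fun k => wave_ordS k N_gt0) oo wd wd' ww r_gt.
have Pcv := kills _ _ _ _ _ _ wave_conjS oo' wd' wd ww' r_gt.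
have := @mean_number R _ N px qy YY jw_acommXY
  (fun j => jw_adj R N _ j (pauliX_adj R)) (fun j => jw_adj R N _ j (pauliY_adj R))
  _ _ (fun k => cis_norm _) (fmode_norm N_gt0) v w vv ww Pv Pcv.
rewrite -bmode_fmode // /qexpectation => ->.
have -> : (2 - (w + w^*)) / 4 = ((1 - (g - c) / d) / 2)%:C.
  have -> : w + w^* = (2 * g%:C - (o + o^*)) / d%:C by rewrite w'E /w; field.
  by rewrite o_re !(fmorph_div, rmorphB, rmorphM, rmorph_nat, rmorph1) /=; field.
by [].
Qed.

End Ising.

(** * Error propagation at the critical point *)

Section Uncertainty.
Variable R : realType.
Local Notation dispersion := (dispersion R).

Lemma dispersion1_sqr (c : R) : c < 1 -> dispersion 1 c ^+ 2 = 2 * (1 - c).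
Proof. by move=> c_lt1; rewrite sqr_sqrtr; [ring|lra]. Qed.

Lemma dispersion1_gt0 (c : R) : c < 1 -> 0 < dispersion 1 c.
Proof.
by move=> c_lt1; rewrite (le_lt_trans _ (dispersion_gt _ _ _ ltr01 c_lt1)).
Qed.

(** At g = 1 the quotient (g - c) / d has derivative 1/d - (1 - c)^2 / d^3, which equals (1 + c) /
    (2d) because d^2 = 2 (1 - c). *)
Lemma is_derive_filling (c : R) : c < 1 ->
  is_derive (1 : R) 1 (fun g => (1 - (g - c) / dispersion g c) / 2)
    (- (1 + c) / (4 * dispersion 1 c)).
Proof.
move=> c_lt1; have d_gt0 := dispersion1_gt0 c c_lt1.
have d2 := dispersion1_sqr c c_lt1.
have dq : is_derive (1 : R) 1 (fun g => 1 + g ^+ 2 - 2 * g * c) (2 - 2 * c).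
  by apply: is_derive_eq; rewrite /GRing.scale /=; ring.
have dd : is_derive (1 : R) 1 (fun g => dispersion g c) ((1 - c) / dispersion 1 c).
  have ds := @is_derive1_sqrt R (1 + 1 ^+ 2 - 2 * 1 * c) ltac:(lra).
  have := @is_derive1_comp R Num.sqrt (fun g => 1 + g ^+ 2 - 2 * g * c) 1 _ _ ds dq.
  move=> ?; apply: is_derive_eq.
  by rewrite -/(dispersion 1 c); field; rewrite gt_eqF.
have dV := @is_deriveV R (fun g => dispersion g c) 1 _ 1 ltac:(by rewrite gt_eqF) dd.
apply: is_derive_eq; rewrite /GRing.scale /=.
clear dq dd dV; move: (dispersion 1 c) d_gt0 d2 => d d_gt0 d2.
have -> : c = 1 - d ^+ 2 / 2 by lra.
by field; rewrite gt_eqF.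
Qed.

(** At g = 1 the variance p (1 - p) is (1 + c) / 8 and the squared slope is (1 + c)^2 / (16 d^2).
    The quotient is 4 (1 - c) / (1 + c), a squared tangent by the half-angle formula. *)
Lemma uncertainty_at_transition (J : R) (N : nat) (Psi : R -> 'cV[R[i]]_(qdim N)) :
    (2 < N)%N -> 0 < J ->
    (forall g, 0 < g -> even_ground_state J (g * J) (Psi g)) ->
  let mean := fun g => qexpectation (occupation R N 1) (Psi g) in
  [/\ derivable mean 1 1, 'D_1 mean 1 != 0 &
      sq_uncertainty (occupation R N 1) Psi 1 = 4 * tan (pi / N%:R) ^+ 2].
Proof.
move=> N_gt2 J_gt0 Psi_gs mean.
have N_gt0 : 0 < N%:R :> R by rewrite ltr0n (leq_trans _ N_gt2).
pose c : R := cos (2 * pi / N%:R).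
have c_lt1 : c < 1 by exact: cos_wave_lt1.
have meanE g : 0 < g -> mean g = (1 - (g - c) / dispersion g c) / 2.
  by move=> g_gt0; exact: mean_occupation (Psi_gs g g_gt0).
have dF := is_derive_filling c c_lt1.
(* The formula for the mean is known only for g > 0, which is enough because differentiation at 1 is
   local. *)
have nearF : \forall g \near (1 : R), (1 - (g - c) / dispersion g c) / 2 = mean g.
  by near=> g; rewrite meanE //; near: g; exact: lt_nbhsr.
have dmean : 'D_1 mean 1 = - (1 + c) / (4 * dispersion 1 c).
  by rewrite -(@near_eq_derive _ _ _ _ _ _ (1 : R) nearF) derive_val.
have d_gt0 := dispersion1_gt0 c c_lt1.
have d2 := dispersion1_sqr c c_lt1.
set t : R := pi / N%:R.
have c2t : c = 2 * cos t ^+ 2 - 1.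
  rewrite [2 * _]mulr_natl -cos_mulr2n /c; congr (cos _).
  by rewrite -mulrA mulr_natl.
have cos_t : 0 < cos t.
  have pi0 := pi_gt0 R; have N_ge2 : 2 < N%:R :> R by rewrite ltr_nat.
  have t_gt0 : 0 < t by rewrite divr_gt0.
  apply: cos_gt0_pihalf; apply/andP; split; first by lra.
  by rewrite ltr_pM2l // ltf_pV2 ?posrE.
(* This keeps the slope nonzero; it rests on pi / N < pi / 2. *)
have c_gt : 0 < 1 + c by rewrite c2t addrC subrK mulr_gt0 // exprn_gt0.
split.
- by apply: near_eq_derivable nearF _; exact: ex_derive.
- by rewrite dmean mulf_neq0 // ?oppr_eq0 ?invr_eq0 ?mulf_neq0 ?gt_eqF.
rewrite /sq_uncertainty dmean /qvariance occupation_idempotent ?(leq_trans _ N_gt2) //.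
rewrite -/(mean 1) meanE //.
have -> : tan t ^+ 2 = (1 - c) / (1 + c).
  rewrite exprMn exprVn sin2cos2 c2t; field.
  by rewrite -c2t !gt_eqF.
clear dF nearF dmean; move: (dispersion 1 c) d_gt0 d2 => d d_gt0 d2.
have cE : c = 1 - d ^+ 2 / 2 by lra.
move: c_gt; rewrite cE => c_gt; field.
by apply/andP; split; rewrite gt_eqF //; lra.
Unshelve. all: end_near.
Qed.

(** By the mean value theorem, since the derivative 1 + tan^2 lies between 1 and 2 on
    [0, pi / 4]. *)
Lemma tan_bounds (t : R) : 0 < t <= pi / 4 -> t <= tan t <= 2 * t.
Proof.
move=> /andP[t_gt0 t_le].
have pi0 := pi_gt0 R.
have cos_pos x : 0 <= x <= t -> 0 < cos x.
  by move=> /andP[x0 xt]; apply: cos_gt0_pihalf; apply/andP; split; lra.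
have [||x] := @MVT R (@tan R) (fun x => cos x ^- 2) 0 t t_gt0.
- move=> x; rewrite in_itv /= => /andP[x0 xt]; apply: is_derive_tan.
  by rewrite gt_eqF // cos_pos // !ltW.
- apply: derivable_within_continuous => x; rewrite in_itv /= => xt.
  by apply: derivable_tan; rewrite gt_eqF // cos_pos.
rewrite in_itv /= => /andP[x0 xt]; rewrite tan0 !subr0 => ->.
have cx : cos x != 0 by rewrite gt_eqF // cos_pos // !ltW.
rewrite cos2_tan2 //.
have tan_x : 0 <= tan x <= 1.
  apply/andP; split; apply: ltW.
    by rewrite -[ltLHS](tan0 R) ltr_tan ?in_itv /=; lra.
  by rewrite -[ltRHS](tan_piquarter R) ltr_tan ?in_itv /=; lra.
have tan_sqr : tan x ^+ 2 <= 1 by case/andP: tan_x => ? ?; exact: exprn_ile1.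
rewrite ler_peMl ?(ltW t_gt0) ?lerDl ?sqr_ge0 //= ler_pM2r //; lra.
Qed.

End Uncertainty.

Theorem mainTheorem1 (R : realType) (J : R) (hJ : 0 < J)
  (Psi : forall m : nat, R -> 'cV[R[i]]_(qdim (2 ^ m)))
  (hPsi : forall (m : nat) (g : R), (2 <= m)%N -> 0 < g ->
     even_ground_state J (g * J) (Psi m g)) :
  (forall m : nat, (2 <= m)%N ->
     let mean := fun g : R => qexpectation (occupation R (2 ^ m) 1) (Psi m g) in
     derivable mean 1 1 /\ 'D_1 mean 1 != 0) /\
  is_Theta
    (fun m : nat => sq_uncertainty (occupation R (2 ^ m) 1) (Psi m) 1)
    (fun m : nat => ((2 ^ m)%:R ^- 2 : R)).
Proof.
have N_ge4 m : (2 <= m)%N -> (4 <= 2 ^ m)%N by move=> m2; rewrite (@leq_pexp2l 2 2).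
have main m (m2 : (2 <= m)%N) := uncertainty_at_transition R J (2 ^ m) (Psi m)
  (leq_trans (isT : 2 < 4)%N (N_ge4 m m2)) hJ (fun g => hPsi m g m2).
split; first by move=> m /main[].
have pi0 := pi_gt0 R.
(* With t = pi / N, [tan_bounds] places 4 tan(t)^2 between 4 t^2 and 16 t^2. The threshold m = 2
   gives N >= 4, hence t <= pi / 4. *)
exists (4 * pi ^+ 2), (16 * pi ^+ 2); split; [by nra|by nra|].
exists 2%N => m m2; have [_ _ ->] := main m m2.
have N4 : 4 <= (2 ^ m)%:R :> R by rewrite ler_nat N_ge4.
have N0 : 0 < (2 ^ m)%:R :> R by lra.
have t_gt0 : 0 < pi / (2 ^ m)%:R :> R by rewrite divr_gt0.
have t_le : pi / (2 ^ m)%:R <= pi / 4 :> R by rewrite ler_pM2l // lef_pV2 ?posrE.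
rewrite -!(mulrA _ (pi ^+ 2)) -!expr_div_n.
have /andP[t_tan tan_t] := tan_bounds R _ (introT andP (conj t_gt0 t_le)).
by apply/andP; split; nra.
Qed.
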